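(* Let $A \in \mathbb{C}^{p\times q}$ and let $A = U\Sigma V^*$ be a singular value decomposition of $A$, i.e., $U\in\mathbb{C}^{p\times p}$ and $V\in\mathbb{C}^{q\times q}$ are unitary and $$U^*AV = \Sigma = \begin{bmatrix} D_\sigma & 0 \\ 0 & 0 \end{bmatrix},$$ with row block sizes $p_1,p_2$ and column block sizes $q_1,q_2$, where $p=p_1+p_2$, $q=q_1+q_2$, $p_1=q_1$, and $D_\sigma=\operatorname{diag}(\sigma_1,\dots,\sigma_{p_1})$ with $\sigma_j>0$ for all $j$. Then the Kronecker canonical form (KCF) of the $(2p+2q)\times(2p+2q)$ pencil $$\mathcal A-\lambda\mathcal B=\begin{bmatrix} 0 & A & 0 & 0 \\ A^* & 0 & 0 & 0 \\ 0 & 0 & I & 0 \\ 0 & 0 & 0 & I \end{bmatrix}-\lambda\begin{bmatrix} 0 & 0 & I & 0 \\ 0 & 0 & 0 & I \\ I & 0 & 0 & 0 \\ 0 & I & 0 & 0 \end{bmatrix}$$ (block rows and block columns of sizes $p,q,p,q$) consists of the following blocks: 1. a series of $p_2+q_2$ blocks $J_2(0)$; 2. the blocks $J_1(\sqrt{\sigma_j})$, $J_1(-\sqrt{\sigma_j})$, $J_1(i\sqrt{\sigma_j})$, $J_1(-i\sqrt{\sigma_j})$ for $j=1,\dots,p_1$, where $\sigma_1,\dots,\sigma_{p_1}$ are the nonzero singular values of $A$.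
   Context: $I$ denotes an identity matrix of appropriate size, and $M^*$ is the Hermitian transpose of $M$. For $\zeta\in\mathbb{C}$, $J_\delta(\zeta)$ denotes the $\delta\times\delta$ pencil $K-\lambda I$, where $K$ is the Jordan block with $\zeta$ on the diagonal and $1$ on the first superdiagonal (so $J_1(\zeta)=\zeta-\lambda$). The Kronecker canonical form of a pencil $\mathcal A-\lambda\mathcal B$ with $\mathcal A,\mathcal B\in\mathbb{C}^{k\times\ell}$ is the block diagonal pencil (unique up to the order of its diagonal blocks) of the standard Kronecker form (zero block, singular blocks $L_\alpha$, $L_\beta^T$, blocks $N_\gamma$ for infinite eigenvalues, blocks $J_\delta(\zeta)$ for finite eigenvalues) that equals $\mathcal Y^*(\mathcal A-\lambda\mathcal B)\mathcal X$ for some nonsingular $\mathcal X\in\mathbb{C}^{\ell\times\ell}$, $\mathcal Y\in\mathbb{C}^{k\times k}$ independent of $\lambda$. ''The KCF consists of the following blocks'' means that there exist such nonsingular $\mathcal X,\mathcal Y$ for which $\mathcal Y^*(\mathcal A-\lambda\mathcal B)\mathcal X$ is block diagonal with exactly the listed blocks (counted with multiplicity) on its diagonal. *)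

(* Defs.v *)
From HB Require Import structures.
From mathcomp Require Import all_boot all_order all_algebra.
From mathcomp Require Import reals complex.

Set Implicit Arguments.
Unset Strict Implicit.
Unset Printing Implicit Defensive.

Import Order.TTheory GRing.Theory Num.Theory.
Local Open Scope ring_scope.
Local Open Scope sesquilinear_scope.

(* KL a is the a x (a+1) block L_a and KLT b the (b+1) x b block L_b^T.  Since
   a = 0 and b = 0 are allowed, the m x n zero block of the Kronecker form is
   the direct sum of m copies of KLT 0 and n copies of KL 0. *)
Inductive kblock (C : Type) : Type :=
  | KL of nat
  | KLT of nat
  | KN of nat
  | KJ of nat & C.

Arguments KL {C}.
Arguments KLT {C}.
Arguments KN {C}.

Section KblockEq.
Variable C : eqType.

Definition kblock_code (b : kblock C) : nat + nat + (nat + nat * C) :=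
  match b with
  | KL a => inl (inl a)
  | KLT a => inl (inr a)
  | KN g => inr (inl g)
  | KJ d z => inr (inr (d, z))
  end.

Definition kblock_decode (c : nat + nat + (nat + nat * C)) : kblock C :=
  match c with
  | inl (inl a) => KL a
  | inl (inr a) => KLT a
  | inr (inl g) => KN g
  | inr (inr (d, z)) => KJ d z
  end.

Lemma kblock_codeK : cancel kblock_code kblock_decode.
Proof. by case. Qed.

HB.instance Definition _ := Equality.copy (kblock C) (can_type kblock_codeK).

End KblockEq.

Section Kronecker.
Variable C : numClosedFieldType.

(* The variable lambda of a pencil is 'X. *)
Definition pencil m n (A B : 'M[C]_(m, n)) : 'M[{poly C}]_(m, n) :=
  map_mx polyC A - 'X *: map_mx polyC B.

Definition jordan_mx n (z : C) : 'M[C]_n :=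
  \matrix_(i, j) (z *+ (i == j) + (i.+1 == j)%:R).

Definition L_pencil a : 'M[{poly C}]_(a, a.+1) :=
  pencil (\matrix_(i, j) (i.+1 == j)%:R) (\matrix_(i, j) (i == j :> nat)%:R).

Definition N_pencil g : 'M[{poly C}]_g := pencil 1%:M (jordan_mx g 0).

Definition J_pencil d (z : C) : 'M[{poly C}]_d := pencil (jordan_mx d z) 1%:M.

Definition kblock_rows (b : kblock C) : nat :=
  match b with KL a => a | KLT a => a.+1 | KN g => g | KJ d _ => d end.

Definition kblock_cols (b : kblock C) : nat :=
  match b with KL a => a.+1 | KLT a => a | KN g => g | KJ d _ => d end.

Definition kblock_pencil (b : kblock C) :
    'M[{poly C}]_(kblock_rows b, kblock_cols b) :=
  match b with
  | KL a => L_pencil a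
  | KLT a => (L_pencil a)^T
  | KN g => N_pencil g
  | KJ d z => J_pencil d z
  end.

(* N and J blocks of size 0 would make the list of blocks non-unique. *)
Definition kblock_wf (b : kblock C) : bool :=
  match b with KN g => 0 < g | KJ d _ => 0 < d | _ => true end%N.

Fixpoint kblocks_rows (s : seq (kblock C)) : nat :=
  if s is b :: s' then (kblock_rows b + kblocks_rows s')%N else 0%N.

Fixpoint kblocks_cols (s : seq (kblock C)) : nat :=
  if s is b :: s' then (kblock_cols b + kblocks_cols s')%N else 0%N.

Fixpoint kblocks_pencil (s : seq (kblock C)) :
    'M[{poly C}]_(kblocks_rows s, kblocks_cols s) :=
  match s with
  | [::] => 0
  | b :: s' => block_mx (kblock_pencil b) 0 0 (kblocks_pencil s')
  end.

Definition has_kcf k l (A B : 'M[C]_(k, l)) (s : seq (kblock C)) : Prop :=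
  all kblock_wf s /\
  exists s' : seq (kblock C), perm_eq s' s /\
  exists (ek : kblocks_rows s' = k) (el : kblocks_cols s' = l)
         (X : 'M[C]_l) (Y : 'M[C]_k),
    [/\ X \in unitmx, Y \in unitmx &
        map_mx polyC (Y^t*) *m pencil A B *m map_mx polyC X
          = castmx (ek, el) (kblocks_pencil s')].

End Kronecker.

(* Main.v *)
(** Write H = [[0, A], [A^*, 0]].  The pencil is [[H, -λI], [-λI, I]], whose
    strict equivalence class depends only on the similarity class of H and
    turns direct sums into direct sums.  The singular value decomposition and
    the change of basis (u, v) -> (u + v, u - v) make H similar to
    diag(D_σ, -D_σ, 0), so only the 1 x 1 case remains: a scalar z^2 <> 0 gives
    J_1(z) + J_1(-z) and the scalar 0 gives J_2(0); finally
    -σ_j = (i sqrt σ_j)^2. *)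

Require Import Defs.
From mathcomp Require Import all_boot all_order all_algebra.
From mathcomp Require Import reals complex.
From mathcomp Require Import ring.

Set Implicit Arguments.
Unset Strict Implicit.
Unset Printing Implicit Defensive.

Import Order.TTheory GRing.Theory Num.Theory.
Local Open Scope ring_scope.
Local Open Scope complex_scope.
Local Open Scope sesquilinear_scope.

(** Reconciles two orders: the theorem groups the blocks by singular value, whereas the reduction to
    diag(D_σ, -D_σ, 0) yields all blocks of the σ_j before those of the -σ_j. *)
Lemma perm_flatten_cat (I : Type) (T : eqType) (f g : I -> seq T) (s : seq I) :
  perm_eq (flatten [seq f i ++ g i | i <- s])
          (flatten [seq f i | i <- s] ++ flatten [seq g i | i <- s]).
Proof.
elim: s => //= i s IHs.
by rewrite -!catA perm_cat2l perm_sym perm_catCA perm_cat2l perm_sym.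
Qed.

(** * Strict equivalence of pencils and direct sums of Kronecker blocks *)

Section StrictEquivalence.
Variable C : numClosedFieldType.
Local Notation "M ^%:P" := (map_mx polyC M) (at level 8, format "M ^%:P").

(* The transformations are rectangular with two-sided inverses, which forces
   m1 = m2 and n1 = n2 but avoids casts between the two formats. *)
Definition strict_equiv m1 n1 m2 n2
    (P : 'M[{poly C}]_(m1, n1)) (Q : 'M[{poly C}]_(m2, n2)) : Prop :=
  exists (Y : 'M[C]_(m2, m1)) (Y' : 'M[C]_(m1, m2))
         (X : 'M[C]_(n1, n2)) (X' : 'M[C]_(n2, n1)),
    [/\ Y *m Y' = 1%:M /\ Y' *m Y = 1%:M,
        X *m X' = 1%:M /\ X' *m X = 1%:M & Y^%:P *m P *m X^%:P = Q].

Lemma strict_equiv_refl m n (P : 'M[{poly C}]_(m, n)) : strict_equiv P P.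
Proof.
exists 1%:M, 1%:M, 1%:M, 1%:M.
by split; rewrite ?map_mx1 ?mulmx1 ?mul1mx.
Qed.

Lemma strict_equiv_trans m1 n1 m2 n2 m3 n3 (P1 : 'M[{poly C}]_(m1, n1))
    (P2 : 'M[{poly C}]_(m2, n2)) (P3 : 'M[{poly C}]_(m3, n3)) :
  strict_equiv P1 P2 -> strict_equiv P2 P3 -> strict_equiv P1 P3.
Proof.
move=> [Y [Y' [X [X' [[YY' Y'Y] [XX' X'X] <-]]]]].
move=> [Z [Z' [W [W' [[ZZ' Z'Z] [WW' W'W] <-]]]]].
exists (Z *m Y), (Y' *m Z'), (X *m W), (W' *m X'); split.
- by rewrite !mulmxA -(mulmxA Z) YY' mulmx1 ZZ' -(mulmxA Y') Z'Z mulmx1.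
- by rewrite !mulmxA -(mulmxA X) WW' mulmx1 XX' -(mulmxA W') X'X mulmx1.
- by rewrite !map_mxM /= !mulmxA.
Qed.

Lemma strict_equiv_cast m1 n1 m2 n2 (e : (m1 = m2) * (n1 = n2))
    (P : 'M[{poly C}]_(m1, n1)) : strict_equiv P (castmx e P).
Proof.
case: e => em en; case: _ / em; case: _ / en.
by rewrite castmx_id; apply: strict_equiv_refl.
Qed.

Lemma strict_equiv_block m1 n1 m2 n2 m3 n3 m4 n4
    (P1 : 'M[{poly C}]_(m1, n1)) (P2 : 'M[{poly C}]_(m2, n2))
    (P3 : 'M[{poly C}]_(m3, n3)) (P4 : 'M[{poly C}]_(m4, n4)) :
  strict_equiv P1 P2 -> strict_equiv P3 P4 ->
  strict_equiv (block_mx P1 0 0 P3) (block_mx P2 0 0 P4).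
Proof.
move=> [Y [Y' [X [X' [[YY' Y'Y] [XX' X'X] <-]]]]].
move=> [Z [Z' [W [W' [[ZZ' Z'Z] [WW' W'W] <-]]]]].
exists (block_mx Y 0 0 Z), (block_mx Y' 0 0 Z').
exists (block_mx X 0 0 W), (block_mx X' 0 0 W').
rewrite !map_block_mx !mulmx_block !map_mx0 !(mulmx0, mul0mx, addr0, add0r).
by rewrite YY' Y'Y XX' X'X ZZ' Z'Z WW' W'W -!scalar_mx_block.
Qed.

Lemma strict_equiv_block0l m n (P : 'M[{poly C}]_(m, n)) :
  strict_equiv (block_mx (0 : 'M_(0, 0)) 0 0 P) P.
Proof.
exists (row_mx 0 1%:M), (col_mx 0 1%:M), (col_mx 0 1%:M), (row_mx 0 1%:M).
have e k : block_mx (0 : 'M[C]_(0, 0)) 0 0 (1%:M : 'M_k) = 1%:M.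
  rewrite [RHS]scalar_mx_block; congr block_mx; exact/esym/flatmx0.
split; rewrite ?mul_row_col ?mul_col_row ?mulmx0 ?mul0mx ?mulmx1 ?add0r //.
rewrite map_row_mx map_col_mx !map_mx0 !map_mx1 mul_row_block.
by rewrite mul_row_col !(mulmx0, mul0mx, mul1mx, mulmx1, add0r).
Qed.

(** Needed because [kblocks_pencil] closes every list, even a singleton, with an empty block. *)
Lemma strict_equiv_block0r m n (P : 'M[{poly C}]_(m, n)) :
  strict_equiv P (block_mx P 0 0 (0 : 'M_(0, 0))).
Proof.
exists (col_mx 1%:M 0), (row_mx 1%:M 0), (row_mx 1%:M 0), (col_mx 1%:M 0).
have e k : block_mx (1%:M : 'M[C]_k) 0 0 (0 : 'M[C]_(0, 0)) = 1%:M.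
  rewrite [RHS]scalar_mx_block; congr block_mx; exact/esym/flatmx0.
split; rewrite ?mul_row_col ?mul_col_row ?mulmx0 ?mul0mx ?mulmx1 ?addr0 //.
rewrite map_row_mx map_col_mx !map_mx0 !map_mx1 mul_col_mx mul_col_row.
by rewrite !(mulmx0, mul0mx, mul1mx, mulmx1).
Qed.

(** [kblocks_pencil] nests to the right, so appending lists is a reassociation of block matrices, up
    to a cast of the dimensions. *)
Lemma kblocks_pencil_cat (s1 s2 : seq (kblock C)) :
  strict_equiv (block_mx (kblocks_pencil s1) 0 0 (kblocks_pencil s2))
               (kblocks_pencil (s1 ++ s2)).
Proof.
elim: s1 => [|b s1 IHs1] /=; first exact: strict_equiv_block0l.
apply: strict_equiv_trans (strict_equiv_block (strict_equiv_refl _) IHs1).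
have := @block_mxA _ _ _ _ _ _ _ (kblock_pencil b) 0 0 0 (kblocks_pencil s1) 0 0 0
  (kblocks_pencil s2).
rewrite !row_mx0 !col_mx0 => /= ->; exact: strict_equiv_cast.
Qed.

Lemma strict_equiv_kblocks_cat m1 n1 m2 n2 (P1 : 'M[{poly C}]_(m1, n1))
    (P2 : 'M[{poly C}]_(m2, n2)) s1 s2 :
  strict_equiv P1 (kblocks_pencil s1) -> strict_equiv P2 (kblocks_pencil s2) ->
  strict_equiv (block_mx P1 0 0 P2) (kblocks_pencil (s1 ++ s2)).
Proof.
move=> eq1 eq2; apply: strict_equiv_trans (kblocks_pencil_cat s1 s2).
exact: strict_equiv_block.
Qed.

(** Two-sided inverses exist only between equal dimensions, which supplies the equations [ek] and
    [el] of [has_kcf]. *)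
Lemma strict_equiv_has_kcf k l (A B : 'M[C]_(k, l)) s s' :
  all (@kblock_wf C) s -> perm_eq s' s ->
  strict_equiv (pencil A B) (kblocks_pencil s') -> has_kcf A B s.
Proof.
move=> wf_s s's [Y [Y' [X [X' [[YY' Y'Y] [XX' X'X] eqY]]]]].
split=> //; exists s'; split=> //.
have ek : kblocks_rows s' = k.
  by apply/eqP; rewrite eqn_leq (mulmx1_min YY') (mulmx1_min Y'Y).
have el : kblocks_cols s' = l.
  by apply/eqP; rewrite eqn_leq (mulmx1_min X'X) (mulmx1_min XX').
exists ek, el; case: _ / ek A B Y Y' YY' Y'Y eqY => A B Y Y' YY' Y'Y eqY.
case: _ / el A B X X' XX' X'X eqY => A B X X' XX' X'X eqY.
exists X, (Y^t*); split.
- by case/mulmx1_unit: XX'.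
- by rewrite map_unitmx unitmx_tr; case/mulmx1_unit: YY'.
- by rewrite trmxCK castmx_id.
Qed.

(** * Similarity and direct sums under [sqrt_pencil] *)

(* Up to a swap of its block rows this is the companion linearization
   [[0, I], [M, 0]] - 'X I of the quadratic matrix polynomial M - 'X^2 I. *)
Definition sqrt_pencil n (M : 'M[C]_n) : 'M[{poly C}]_(n + n) :=
  block_mx M^%:P (- 'X)%:M (- 'X)%:M 1%:M.

(** The same change of basis acts on both halves; the three blocks other than [M] are scalar and
    commute with it. *)
Lemma sqrt_pencil_sim n1 n2 (M : 'M[C]_n1) (W : 'M[C]_(n1, n2))
    (W' : 'M[C]_(n2, n1)) :
  W *m W' = 1%:M -> W' *m W = 1%:M ->
  strict_equiv (sqrt_pencil M) (sqrt_pencil (W' *m M *m W)).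
Proof.
move=> WW' W'W; exists (block_mx W' 0 0 W'), (block_mx W 0 0 W).
exists (block_mx W 0 0 W), (block_mx W' 0 0 W').
rewrite !mulmx_block !(mulmx0, mul0mx, addr0, add0r) WW' W'W -!scalar_mx_block.
split=> //; rewrite /sqrt_pencil !map_block_mx !map_mx0 !mulmx_block.
rewrite !(mulmx0, mul0mx, addr0, add0r) mulmx1 !mul_mx_scalar -!scalemxAl.
by rewrite -!map_mxM /= W'W map_mx1 !scalemx1.
Qed.

Lemma sqrt_pencil_block n1 n2 (M1 : 'M[C]_n1) (M2 : 'M[C]_n2) :
  strict_equiv (sqrt_pencil (block_mx M1 0 0 M2))
               (block_mx (sqrt_pencil M1) 0 0 (sqrt_pencil M2)).
Proof.
(* The permutation that exchanges the two middle groups of coordinates, [n2] and [n1]. *)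
pose W : 'M[C]_((n1 + n2) + (n1 + n2), (n1 + n1) + (n2 + n2)) :=
  block_mx (block_mx 1%:M 0 0 0) (block_mx 0 0 1%:M 0)
           (block_mx 0 1%:M 0 0) (block_mx 0 0 0 1%:M).
pose W' : 'M[C]_((n1 + n1) + (n2 + n2), (n1 + n2) + (n1 + n2)) :=
  block_mx (block_mx 1%:M 0 0 0) (block_mx 0 0 1%:M 0)
           (block_mx 0 1%:M 0 0) (block_mx 0 0 0 1%:M).
pose simp := (mulmx_block, add_block_mx, mulmx0, mul0mx, mulmx1, mul1mx, addr0,
  add0r).
have WW' : W *m W' = 1%:M.
  by rewrite /W /W' !simp -!scalar_mx_block !block_mx0 -scalar_mx_block.
have W'W : W' *m W = 1%:M.
  by rewrite /W /W' !simp -!scalar_mx_block !block_mx0 -scalar_mx_block.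
exists W', W, W, W'; split=> //.
rewrite /W /W' /sqrt_pencil !map_block_mx !map_mx0 !map_mx1 !scalar_mx_block.
by rewrite !simp !block_mx0.
Qed.

Lemma sqrt_pencil_diag n (d : 'rV[C]_n) (g : 'I_n -> seq (kblock C)) :
  (forall j, strict_equiv (sqrt_pencil ((d 0 j)%:M : 'M_1)) (kblocks_pencil (g j))) ->
  strict_equiv (sqrt_pencil (diag_mx d))
               (kblocks_pencil (flatten [seq g j | j <- enum 'I_n])).
Proof.
elim: n d g => [|n IHn] d g dg.
  have -> : enum 'I_0 = [::] by apply: size0nil; rewrite size_enum_ord.
  rewrite /= [sqrt_pencil _]flatmx0; exact: strict_equiv_refl.
rewrite enum_ordSl /= -map_comp.
(* Reading the size [n.+1] as [1 + n] splits off the first diagonal entry. *)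
have dE : diag_mx (d : 'rV_(1 + n)) =
    block_mx (d 0 ord0)%:M 0 0 (diag_mx (\row_j d 0 (lift ord0 j))).
  apply: etrans (congr1 (@diag_mx _ (1 + n)) (esym (@hsubmxK _ 1 1 n d))) _.
  rewrite diag_mx_row.
  congr (block_mx _ _ _ (diag_mx _)).
    apply/matrixP=> i j; rewrite !ord1 !mxE; congr (d _ _ *+ _); exact: val_inj.
  by apply/rowP=> j; rewrite !mxE; congr (d _ _); apply: val_inj.
rewrite dE; apply: strict_equiv_trans (@sqrt_pencil_block 1 n _ _) _.
apply: strict_equiv_kblocks_cat; first exact: dg.
by apply: IHn => j; rewrite mxE; apply: dg.
Qed.

(** * The canonical form for a single scalar *)

Lemma J_pencil1 (z : C) : J_pencil 1 z = (z%:P - 'X)%:M.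
Proof.
by apply/matrixP=> i j; rewrite !ord1 !mxE /= addr0 !mulr1n mulr1.
Qed.

Lemma sqrt_pencil_sqr (z : C) : z != 0 ->
  strict_equiv (sqrt_pencil ((z ^+ 2)%:M : 'M_1))
               (kblocks_pencil [:: KJ 1 z; KJ 1 (- z)]).
Proof.
move=> z0; rewrite /=.
apply: (@strict_equiv_trans _ _ _ _ _ _ _
  (block_mx (J_pencil 1 z) 0 0 (J_pencil 1 (- z)))); last first.
  apply: strict_equiv_block (strict_equiv_refl _) (strict_equiv_block0r _).
pose B (a b c d : C) : 'M[C]_(1 + 1) := block_mx a%:M b%:M c%:M d%:M.
have BM a b c d a' b' c' d' : B a b c d *m B a' b' c' d' =
  B (a * a' + b * c') (a * b' + b * d') (c * a' + d * c') (c * b' + d * d').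
  by rewrite /B mulmx_block -!scalar_mxM -!raddfD.
have B1 : B 1 0 0 1 = 1%:M by rewrite [RHS]scalar_mx_block /B !raddf0.
(* The pencil maps (1, z) to (z - λ)(z, 1) and (1, -z) to (-z - λ)(-z, 1). The source vectors are
   the columns of the right factor, the target vectors those of the inverse of the left factor; both
   pairs are independent since [z != 0]. *)
exists (B (2 * z)^-1 2^-1 (- (2 * z)^-1) 2^-1), (B z (- z) 1 1).
exists (B 1 1 z (- z)), (B 2^-1 (2 * z)^-1 2^-1 (- (2 * z)^-1)).
split; rewrite ?BM -?B1; try by split; congr B; field; rewrite ?z0.
rewrite /B /sqrt_pencil !map_block_mx !map_scalar_mx /= !mulmx_block !J_pencil1.
rewrite -!scalar_mxM -!raddfD /= -!scalar_mxM -!raddfD /=.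
rewrite !polyCN.
(* For [ring], the constant polynomials of inverses are opaque. They are all written through
   [((2 * z)^-1)%:P], and its relation [u2z] is inserted by hand where needed. *)
have uz : (2^-1)%:P = ((2 * z)^-1)%:P * z%:P.
  by rewrite -polyCM; congr polyC; field; rewrite z0.
have u2z : 2 * ((2 * z)^-1)%:P * z%:P = 1.
  by rewrite -polyC_natr -!polyCM -polyC1; congr polyC; field; rewrite z0.
rewrite uz polyC1 !mulr1 -[0 in RHS](raddf0 (@scalar_mx _ 1)).
congr (block_mx _%:M _%:M _%:M _%:M).
- by rewrite -[RHS]mul1r -u2z; ring.
- by ring.
- by ring.
- by rewrite -[RHS]mul1r -u2z; ring.
Qed.

Lemma sqrt_pencil0 :
  strict_equiv (sqrt_pencil (0%:M : 'M_1)) (kblocks_pencil [:: KJ 2 0]).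
Proof.
rewrite /=; apply: strict_equiv_trans (strict_equiv_block0r _).
(* Swapping the rows of [[0, -λ], [-λ, 1]] gives [[-λ, 1], [0, -λ]], which is J_2(0). *)
pose S : 'M[C]_(1 + 1) := block_mx 0 1%:M 1%:M 0.
have SS : S *m S = 1%:M.
  rewrite mulmx_block !(mulmx0, mul0mx, mulmx1, addr0, add0r).
  by rewrite -scalar_mx_block.
exists S, S, 1%:M, 1%:M; split; rewrite ?mulmx1 // map_mx1 mulmx1.
apply: (@etrans _ _ (block_mx (- 'X)%:M 1%:M 0 (- 'X)%:M : 'M_(1 + 1))).
  rewrite -[LHS]/(map_mx polyC S *m sqrt_pencil 0%:M).
  rewrite /S /sqrt_pencil !map_block_mx !map_mx0 !map_mx1 mulmx_block.
  by rewrite map_scalar_mx raddf0 !(mulmx0, mul0mx, mul1mx, addr0, add0r).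
apply/matrixP=> i j; rewrite !mxE mul0rn add0r.
rewrite [i == j](_ : _ = (i == j :> nat)) //.
by case: (splitP i) => i' ->; rewrite !ord1 !mxE; case: (splitP j) => j' ->;
  rewrite !ord1 ?mxE /= ?(mulr0, mulr1, subr0, sub0r, mulr1n, oppr0).
Qed.

(** * Diagonalization through the singular value decomposition *)

Lemma pencil_sqrt n (M : 'M[C]_n) :
  pencil (block_mx M 0 0 1%:M) (block_mx 0 1%:M 1%:M 0) = sqrt_pencil M.
Proof.
rewrite /pencil !map_block_mx !map_mx0 !map_mx1 scale_block_mx opp_block_mx.
by rewrite add_block_mx !scaler0 !subr0 !sub0r scalemx1 -raddfN.
Qed.

Lemma sqrt_pencil_svd p1 p2 q2 (A : 'M[C]_(p1 + p2, p1 + q2))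
    (U : 'M[C]_(p1 + p2)) (V : 'M[C]_(p1 + q2)) (d : 'rV[C]_p1) :
  U \is unitarymx -> V \is unitarymx -> (diag_mx d)^t* = diag_mx d ->
  U^t* *m A *m V = block_mx (diag_mx d) 0 0 0 ->
  strict_equiv (sqrt_pencil (block_mx 0 A (A^t*) 0))
    (sqrt_pencil (diag_mx (row_mx (row_mx d (- d)) (0 : 'rV_(p2 + q2))))).
Proof.
move=> /unitarymxP UU /unitarymxP VV dd svd.
(* The conjugate transpose of [svd], whose diagonal block is unchanged because it is Hermitian. *)
have svd' : V^t* *m A^t* *m U = block_mx (diag_mx d) 0 0 0.
  rewrite -dd -!mulmxA.
  have := congr1 (fun M => M^t*) svd.
  by rewrite tr_block_mx map_block_mx !trmx0 !map_mx0 !trmx_mul !map_mxM /=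
     trmxCK => <-.
have [VV' UU'] := (mulmx1C VV, mulmx1C UU).
apply: strict_equiv_trans
  (@sqrt_pencil_sim _ _ _ (block_mx U 0 0 V) (block_mx (U^t*) 0 0 (V^t*)) _ _)
  _.
- by rewrite mulmx_block !(mulmx0, mul0mx, addr0, add0r) UU VV -scalar_mx_block.
- by rewrite mulmx_block !(mulmx0, mul0mx, addr0, add0r) UU' VV' -scalar_mx_block.
rewrite !mulmx_block !(mulmx0, mul0mx, addr0, add0r) svd svd'.
(* The first two block columns are u + v and u - v, with eigenvalues [d] and [- d]; the last two
   select the [p2] and [q2] coordinates, on which the matrix vanishes. *)
pose W : 'M[C]_((p1 + p2) + (p1 + q2), (p1 + p1) + (p2 + q2)) :=
  block_mx (block_mx 1%:M 1%:M 0 0) (block_mx 0 0 1%:M 0)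
           (block_mx 1%:M (- 1%:M) 0 0) (block_mx 0 0 0 1%:M).
pose h : 'M[C]_p1 := (2^-1)%:M.
pose W' : 'M[C]_((p1 + p1) + (p2 + q2), (p1 + p2) + (p1 + q2)) :=
  block_mx (block_mx h 0 h 0) (block_mx h 0 (- h) 0)
           (block_mx 0 1%:M 0 0) (block_mx 0 0 0 1%:M).
pose simp := (mulmx_block, add_block_mx, mulmx0, mul0mx, mulmx1, mul1mx, addr0,
  add0r, mulmxN, mulNmx, subrr, opprK, addNr, oppr0).
have hh : h + h = 1%:M.
  by rewrite -raddfD; congr _%:M; field.
have WW' : W *m W' = 1%:M.
  by rewrite /W /W' !simp hh -!scalar_mx_block !block_mx0 -scalar_mx_block.
have W'W : W' *m W = 1%:M.
  by rewrite /W /W' !simp hh -!scalar_mx_block !block_mx0 -scalar_mx_block.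
apply: strict_equiv_trans (sqrt_pencil_sim _ WW' W'W) _.
have hD D : h *m D + h *m D = D by rewrite -mulmxDl hh mul1mx.
rewrite /W /W' !simp -opprD !hD !diag_mx_row !raddfN !raddf0 !block_mx0.
exact: strict_equiv_refl.
Qed.

End StrictEquivalence.

(** * Collecting the blocks of D_σ, -D_σ and 0 *)

Theorem theorem3p3 (R : realType) (p1 p2 q2 : nat)
    (A : 'M[R[i]]_(p1 + p2, p1 + q2))
    (U : 'M[R[i]]_(p1 + p2)) (V : 'M[R[i]]_(p1 + q2)) (sigma : 'rV[R]_p1)
    (U_unitary : U \is unitarymx) (V_unitary : V \is unitarymx)
    (sigma_gt0 : forall j : 'I_p1, 0 < sigma 0 j)
    (A_svd : U^t* *m A *m V =
       block_mx (diag_mx (map_mx (real_complex R) sigma)) 0 0 0) :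
  has_kcf
    (block_mx (block_mx 0 A (A^t*) 0) (block_mx 0 0 0 0)
              (block_mx 0 0 0 0)      (block_mx 1%:M 0 0 1%:M))
    (block_mx (block_mx 0 0 0 0)       (block_mx 1%:M 0 0 1%:M)
              (block_mx 1%:M 0 0 1%:M) (block_mx 0 0 0 0))
    (nseq (p2 + q2) (KJ 2 0) ++
     flatten [seq [:: KJ 1 (Num.sqrt (sigma 0 j))%:C;
                      KJ 1 (- (Num.sqrt (sigma 0 j))%:C);
                      KJ 1 ('i * (Num.sqrt (sigma 0 j))%:C);
                      KJ 1 (- ('i * (Num.sqrt (sigma 0 j))%:C))]
             | j <- enum 'I_p1]).
Proof.
pose s j : R[i] := (Num.sqrt (sigma 0 j))%:C.
have s2 j : s j ^+ 2 = (sigma 0 j)%:C.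
  by rewrite -rmorphXn /= sqr_sqrtr // ltW.
have s0 j : s j != 0 by rewrite fmorph_eq0 sqrtr_eq0 -ltNge.
have i0 : 'i != 0 :> R[i] by rewrite -sqrf_eq0 sqr_i oppr_eq0 oner_eq0.
pose g1 j : seq (kblock R[i]) := [:: KJ 1 (s j); KJ 1 (- s j)].
pose g2 j : seq (kblock R[i]) := [:: KJ 1 ('i * s j); KJ 1 (- ('i * s j))].
(* The list follows the order of diag(D_σ, -D_σ, 0), with the [J_2(0)] blocks indexed by an
   enumeration to fit [sqrt_pencil_diag]. *)
apply: (@strict_equiv_has_kcf _ _ _ _ _ _
  ((flatten [seq g1 j | j <- enum 'I_p1] ++ flatten [seq g2 j | j <- enum 'I_p1])
   ++ flatten [seq [:: KJ 2 0] | j <- enum 'I_(p2 + q2)])).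
- rewrite all_cat all_nseq orbT /=.
  by apply/allP=> b /flatten_mapP[j _]; rewrite !inE => /or4P[] /eqP->.
- have -> : flatten [seq [:: KJ 2 0] | j <- enum 'I_(p2 + q2)]
      = nseq (p2 + q2) (KJ 2 (0 : R[i])).
    by rewrite -[in RHS](size_enum_ord (p2 + q2)); elim: (enum _) => //= ? ? ->.
  rewrite perm_catC perm_cat2l perm_sym.
  exact: (perm_flatten_cat g1 g2).
rewrite block_mx0 -scalar_mx_block pencil_sqrt.
apply: strict_equiv_trans (sqrt_pencil_svd U_unitary V_unitary _ A_svd) _.
  (* The singular values are real, so their diagonal matrix is Hermitian. *)
  rewrite tr_diag_mx map_diag_mx -map_mx_comp; congr diag_mx.
  by apply/rowP=> j; rewrite !mxE; apply: conjc_real.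
rewrite !diag_mx_row.
apply: strict_equiv_trans (sqrt_pencil_block _ _) _.
apply: strict_equiv_kblocks_cat; last first.
  by apply: sqrt_pencil_diag => j; rewrite mxE; apply: sqrt_pencil0.
apply: strict_equiv_trans (sqrt_pencil_block _ _) _.
apply: strict_equiv_kblocks_cat; apply: sqrt_pencil_diag => j; rewrite !mxE.
  by rewrite -[real_complex R _]s2; apply: sqrt_pencil_sqr.
have -> : - (real_complex R (sigma 0 j)) = ('i * s j) ^+ 2.
  by rewrite exprMn s2 sqr_i mulN1r.
by apply: sqrt_pencil_sqr; rewrite mulf_neq0.
Qed.
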